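(* $M(76)=7$.
   Context: For a positive integer $n$, $\tau(n)$ denotes the number of positive divisors of $n$. For a positive integer $k$, $M(k)$ denotes the maximal length of a run of consecutive positive integers each having exactly $k$ divisors, i.e. the largest $L$ for which there is a positive integer $n$ with $\tau(n)=\tau(n+1)=\dots=\tau(n+L-1)=k$. *)

(* Defs.v *)
From mathcomp Require Import all_boot.

Set Implicit Arguments.
Unset Strict Implicit.
Unset Printing Implicit Defensive.

Definition tau (n : nat) : nat := size (divisors n).

Definition has_run (k L : nat) : Prop :=
  exists2 n : nat, 0 < n & forall i : nat, i < L -> tau (n + i) = k.

(* M(k) = L, as a relation: the maximum is attained and is an upper bound, so
   [is_M k L] also asserts that the lengths of runs are bounded. *)
Definition is_M (k L : nat) : Prop :=
  has_run k L /\ forall L' : nat, has_run k L' -> L' <= L.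

Lemma is_M_unique (k L1 L2 : nat) : is_M k L1 -> is_M k L2 -> L1 = L2.
Proof.
move=> [run1 max1] [run2 max2].
by apply/eqP; rewrite eqn_leq max2 // max1.
Qed.

(* Main.v *)
Require Import Defs.
From mathcomp Require Import all_boot.
From Stdlib Require Import BinPos.

Set Implicit Arguments.
Unset Strict Implicit.
Unset Printing Implicit Defensive.

(** Among eight consecutive integers one is congruent to 4 modulo 8. It is 4
    times an odd number, so its number of divisors is a multiple of 3, and 76
    is not one ([run76_le7]).

    A run of length 7 is exhibited.  It starts at a number [run_start] of 115
    digits, and its terms [run_start + i], 0 <= i < 7, have the form
    r^18 * a * b with distinct primes r, a, b, hence 19 * 2 * 2 divisors
    ([tau76]).  The primes r are 2, 3, 5, 7, 11, 13 and 17; choosing which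
    term each of them divides fixes the run modulo their 18th powers.  The
    term divisible by 2^18 lies in the middle, so that the terms at distance 2
    from it are twice an odd number and have a = 2, and the other multiple of
    3 has a = 3.  Along the resulting arithmetic progression the remaining
    cofactors, a * b or just b, have no further forced divisor, and a sieve
    finds a place where all of them factor as wanted.

    What is left is to prove that the large cofactors b, of 83 to 106 digits,
    are prime.  The criterion of Pocklington ([pocklington]) reduces the
    primality of n to that of some primes whose product divides n - 1 and
    exceeds the square root of n, and to a few powers modulo n.  Descending to
    smaller and smaller primes, this gives the list [prime_chain] of
    certificates; [check_chain] verifies it by computation on binary numbers,
    where Montgomery reduction makes modular powers cheap. *)

(** * The divisor function *)

(** The divisors of m * n are the products d * e of a divisor of m and one of
    n, and d, e are recovered from d * e by a gcd with m and with n. *)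
Lemma tauM m n : coprime m n -> 0 < m -> 0 < n -> tau (m * n) = tau m * tau n.
Proof.
move=> co_mn m_gt0 n_gt0.
rewrite /tau -(size_allpairs muln); apply: perm_size; apply: uniq_perm.
- exact: divisors_uniq.
- apply: allpairs_uniq; [exact: divisors_uniq | exact: divisors_uniq |].
  have gcd_part d e : d %| m -> e %| n ->
      gcdn m (d * e) = d /\ gcdn n (d * e) = e.
    move=> dv_d dv_e; split.
      by rewrite (Gauss_gcdl _ (coprime_dvdr dv_e co_mn)); apply/gcdn_idPr.
    rewrite Gauss_gcdr; first exact/gcdn_idPr.
    by rewrite coprime_sym (coprime_dvdl dv_d).
  move=> x y /allpairsP[[d e] /= [d_m e_n ->]].
  move=> /allpairsP[[d' e'] /= [d'_m e'_n ->]] /= eq_de.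
  move: d_m e_n d'_m e'_n; rewrite -!dvdn_divisors // => dv_d dv_e dv_d' dv_e'.
  have [gcd_d gcd_e] := gcd_part _ _ dv_d dv_e.
  have [gcd_d' gcd_e'] := gcd_part _ _ dv_d' dv_e'.
  congr (_, _); first by rewrite -gcd_d -gcd_d' eq_de.
  by rewrite -gcd_e -gcd_e' eq_de.
move=> x; rewrite -dvdn_divisors ?muln_gt0 ?m_gt0 //.
apply/idP/allpairsP => [dv_x | [[d e] /= [+ + ->]]]; last first.
  by rewrite -!dvdn_divisors //; apply: dvdn_mul.
exists (gcdn x m, gcdn x n); rewrite -!dvdn_divisors ?dvdn_gcdr //; split=> //=.
apply/eqP; rewrite eqn_dvd; apply/andP; split.
  rewrite muln_gcdr !muln_gcdl !dvdn_gcd dv_x.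
  by rewrite !(dvdn_mulr _ (dvdnn x)) !(dvdn_mull _ (dvdnn x)).
rewrite Gauss_dvd ?dvdn_gcdl //.
by apply: coprime_dvdl (dvdn_gcdr _ _) _; apply: coprime_dvdr (dvdn_gcdr _ _) _.
Qed.

Lemma tau_prime_power p k : prime p -> tau (p ^ k) = k.+1.
Proof.
move=> pr_p; rewrite /tau -[RHS](size_iota 0) -(size_map (expn p) (iota _ _)).
apply: perm_size; apply: uniq_perm.
- exact: divisors_uniq.
- rewrite map_inj_uniq ?iota_uniq // => i j /eqP.
  by rewrite eqn_exp2l ?prime_gt1 // => /eqP.
move=> d; rewrite -dvdn_divisors ?expn_gt0 ?prime_gt0 //.
apply/(dvdn_pfactor _ _ pr_p)/mapP => [[i le_ik ->] | [i]].
  by exists i; rewrite // mem_iota.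
by rewrite mem_iota => /= lt_ik ->; exists i.
Qed.

Lemma tau_prime p : prime p -> tau p = 2.
Proof. by move=> pr_p; rewrite -{1}(expn1 p) tau_prime_power. Qed.

Lemma tau76 r a b : prime r -> prime a -> prime b ->
  r != a -> r != b -> a != b -> tau (r ^ 18 * (a * b)) = 76.
Proof.
move=> pr_r pr_a pr_b neq_ra neq_rb neq_ab.
have co p q : prime p -> prime q -> p != q -> coprime p q.
  by move=> pr_p pr_q neq_pq; rewrite prime_coprime // dvdn_prime2.
have pos := prime_gt0.
rewrite tauM ?coprimeXl ?coprimeMr ?co ?muln_gt0 ?expn_gt0 ?pos //.
by rewrite (tauM (co a b _ _ _)) ?pos // tau_prime_power // !tau_prime.
Qed.

(** * Runs have length at most seven *)

Lemma run76_le7 L : has_run 76 L -> L <= 7.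
Proof.
case=> n n_gt0 run; rewrite leqNgt; apply/negP => lt7L.
pose i := (12 - n %% 8) %% 8.
have def4 : (n + i) %% 8 = 4.
  by rewrite modnDmr -modnDml; case: (n %% 8) (ltn_pmod n (isT : 0 < 8));
     do 8?[case=> //].
have := run i (leq_trans (ltn_pmod _ (isT : 0 < 8)) lt7L).
set h := (n + i) %/ 8.
have -> : n + i = 2 ^ 2 * h.*2.+1.
  by rewrite (divn_eq (n + i) 8) def4 [RHS]mulnS -muln2 mulnCA [LHS]addnC.
rewrite tauM ?coprimeXl ?coprime2n /= ?odd_double //.
rewrite tau_prime_power // => /(congr1 (modn^~ 3)).
by rewrite modnMr.
Qed.

(** * Pocklington's criterion *)

(** With g := gcd (m, r - 1), Fermat's little theorem and a Bezout relation
    give a^g = 1 modulo r.  If the q-part of m did not divide r - 1, then g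
    would divide m / q, and a^(m / q) would be 1 as well. *)
Lemma part_dvd_pred m q r a : prime q -> prime r -> 0 < m -> q %| m ->
  a ^ m = 1 %[mod r] -> a ^ (m %/ q) != 1 %[mod r] -> m`_q %| r.-1.
Proof.
move=> pr_q pr_r m_gt0 dv_qm am1; apply: contraR => ndv.
have r_gt1 := prime_gt1 pr_r.
have r1_gt0 : 0 < r.-1 by rewrite -subn1 subn_gt0.
have co_ra : coprime r a.
  have: coprime r (a ^ m) by rewrite -coprime_modr am1 coprime_modr coprimen1.
  by rewrite coprime_pexpr.
have ar1 : a ^ r.-1 = 1 %[mod r].
  apply/eqP; have := fermat_little a pr_r.
  rewrite -{1}(prednK (prime_gt0 pr_r)) expnS => /eqP.
  have a_gt0 : 0 < a.
    by move: co_ra; case: (a) => //; rewrite /coprime gcdn0 (gtn_eqF r_gt1).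
  rewrite eqn_mod_dvd ?leq_pmulr ?expn_gt0 ?a_gt0 //.
  rewrite -{3}(muln1 a) -mulnBr Gauss_dvdr // => dv.
  by rewrite eqn_mod_dvd ?expn_gt0 ?a_gt0.
have pow1 x k : x = 1 %[mod r] -> x ^ k = 1 %[mod r].
  by move=> x1; rewrite -modnXm x1 modnXm exp1n.
set g := gcdn m r.-1.
have ag1 : a ^ g = 1 %[mod r].
  have [u v def_g _] := egcdnP r.-1 m_gt0.
  have := pow1 _ u am1; rewrite -expnM mulnC def_g expnD -modnMml.
  by rewrite (mulnC v) expnM pow1 // modnMml mul1n.
have def_m : m = m %/ g * g by rewrite divnK ?dvdn_gcdl.
have dv_q : q %| m %/ g.
  apply: contraR ndv => ndv_q; apply: dvdn_trans (dvdn_gcdr m _).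
  rewrite -/g {1}def_m partnM ?divn_gt0 ?gcdn_gt0 ?m_gt0 //; last first.
    by rewrite dvdn_leq ?dvdn_gcdl.
  rewrite part_p'nat ?mul1n ?dvdn_part //.
  by rewrite p'natE // divn_gt0 ?gcdn_gt0 ?m_gt0 // dvdn_leq ?dvdn_gcdl.
by rewrite {1}def_m -mulnC -muln_divA // expnM pow1.
Qed.

(** Every prime divisor r of n is 1 modulo f: [part_dvd_pred] applies at each
    prime divisor q of f, because a^((n - 1) / q) - 1 is a unit modulo n.  So
    r > f and r^2 > n, which leaves n no proper prime divisor.  The summand
    n.-1 stands for -1 modulo n. *)
Lemma pocklington n a c (qs : seq nat) (f := \prod_(q <- qs) q) :
    n = (c * f).+1 -> 1 < n -> n < f * f -> all prime qs ->
    a ^ n.-1 = 1 %[mod n] ->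
    {in qs, forall q, coprime n (a ^ (n.-1 %/ q) + n.-1)} ->
  prime n.
Proof.
move=> def_n n_gt1 lt_nff pr_qs an1 co_qs.
apply: ltn_pdiv2_prime (ltnW n_gt1) _.
set r := pdiv n; have pr_r : prime r by rewrite pdiv_prime.
have dv_rn : r %| n by exact: pdiv_dvd.
have r1_gt0 : 0 < r.-1 by rewrite -subn1 subn_gt0 prime_gt1.
have f_gt0 : 0 < f by move: lt_nff; case: (f).
suffices dv_f : f %| r.-1.
  apply: leq_trans lt_nff _; rewrite -mulnn.
  by apply: leq_mul; apply: leq_trans (dvdn_leq r1_gt0 dv_f) (leq_pred r).
have n1_gt0 : 0 < n.-1 by rewrite -subn1 subn_gt0.
have dv_fn : f %| n.-1 by rewrite def_n dvdn_mull.
apply/dvdn_partP => // q; rewrite mem_primes => /and3P[pr_q _ dv_qf].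
have qs_q : q \in qs.
  have := dv_qf; rewrite Euclid_dvd_prod // big_has => /hasP[p qs_p dv_qp].
  by move: dv_qp; rewrite dvdn_prime2 ?(allP pr_qs p qs_p) // => /eqP ->.
apply: dvdn_trans (partn_dvd q n1_gt0 dv_fn) _.
apply: (@part_dvd_pred _ _ _ a pr_q pr_r n1_gt0 (dvdn_trans dv_qf dv_fn)).
  by rewrite -(modn_dvdm (a ^ _) dv_rn) an1 modn_dvdm.
apply/eqP => aq1; have := coprime_dvdl dv_rn (co_qs q qs_q).
rewrite prime_coprime // /dvdn -modnDml aq1 modnDml add1n prednK ?(ltnW n_gt1) //.
by rewrite -/(r %| n) dv_rn.
Qed.

(** * Modular powers of binary numbers *)

(** Exact halving of even numbers; odd numbers are left alone. *)
Definition pos_half (x : positive) : positive := if x is xO y then y else x.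

Lemma double_pos_half x : ~~ odd (nat_of_pos x) ->
  (nat_of_pos (pos_half x)).*2 = nat_of_pos x.
Proof.
by case: x => [x|x|] //=; rewrite NatTrec.doubleE //= odd_double.
Qed.

Section Montgomery.

Variables (n : positive) (k : nat).
Let N := nat_of_pos n.

(** Division by 2 modulo an odd n: an odd x is first made even by adding n. *)
Definition halve (x : positive) : positive :=
  if x is xO y then y else pos_half (Pos.add x n).

(** Montgomery reduction, that is, division by 2 ^ k modulo n.  It adds at most
    2 ^ k * n before dividing, so that for 2 ^ k above a small multiple of n it
    brings the square of a number of the size of n back to that size. *)
Definition redc (x : positive) : positive := iter k halve x.

Definition double_mod (x : positive) : positive :=
  let y := xO x in if Pos.ltb n y then Pos.sub y n else y.

(** The power of exponent e in Montgomery form, where b is the Montgomery form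
    a * 2 ^ k of a.  Multiplying by the small number a itself, rather than by
    b, needs no reduction. *)
Fixpoint mont_exp (a b : positive) (e : positive) : positive :=
  match e with
  | xH => b
  | xO e' => redc (Pos.square (mont_exp a b e'))
  | xI e' => Pos.mul a (redc (Pos.square (mont_exp a b e')))
  end.

Definition pow_mod (a e : positive) : positive :=
  redc (mont_exp a (iter k double_mod a) e).

Lemma halveP x w : odd N -> nat_of_pos x = 2 * w %[mod N] ->
  nat_of_pos (halve x) = w %[mod N].
Proof.
move=> oddN eq_x.
have double_halve : (nat_of_pos (halve x)).*2 = nat_of_pos x %[mod N].
  have odd_case z : odd (nat_of_pos z) ->
      (nat_of_pos (pos_half (Pos.add z n))).*2 = nat_of_pos z %[mod N].
    move=> odd_z; rewrite double_pos_half nat_of_add_pos ?modnDr //.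
    by rewrite oddD odd_z oddN.
  case: (x) => [z|z|]; rewrite /halve ?odd_case //= NatTrec.doubleE //.
  by rewrite /= odd_double.
(* (N + 1) / 2 is the inverse of 2 modulo N. *)
have half_mul u : u = uphalf N * (2 * u) %[mod N].
  have def2 : uphalf N * 2 = N.+1.
    by rewrite muln2 -[in RHS](odd_double_half N) uphalf_half oddN.
  by rewrite mulnA def2 mulSn -modnDmr modnMr addn0.
rewrite half_mul [in RHS]half_mul [in LHS]mul2n -modnMmr double_halve eq_x.
by rewrite modnMmr.
Qed.

Lemma redcP x w : odd N -> nat_of_pos x = w * 2 ^ k %[mod N] ->
  nat_of_pos (redc x) = w %[mod N].
Proof.
move=> oddN; rewrite /redc; elim: (k) x w => [|m IHm] x w eq_x.
  by rewrite muln1 in eq_x.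
by rewrite iterS; apply: halveP => //; apply: IHm; rewrite eq_x expnS mulnCA mulnA.
Qed.

Lemma double_modP x : nat_of_pos (double_mod x) = 2 * nat_of_pos x %[mod N].
Proof.
rewrite /double_mod mul2n -NatTrec.doubleE -[NatTrec.double _]/(nat_of_pos (xO x)).
case lt_ny: Pos.ltb => //.
move/Pos.ltb_lt/Pos.sub_add: lt_ny => {2}<-.
by rewrite nat_of_add_pos modnDr.
Qed.

Lemma mont_expP a b e : odd N -> nat_of_pos b = nat_of_pos a * 2 ^ k %[mod N] ->
  nat_of_pos (mont_exp a b e) = nat_of_pos a ^ nat_of_pos e * 2 ^ k %[mod N].
Proof.
move=> oddN eq_b; set A := nat_of_pos a.
have sqP e' : nat_of_pos (mont_exp a b e') = A ^ nat_of_pos e' * 2 ^ k %[mod N] ->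
    nat_of_pos (redc (Pos.square (mont_exp a b e'))) =
      A ^ (nat_of_pos e').*2 * 2 ^ k %[mod N].
  move=> IHe; apply: redcP => //; rewrite Pos.square_spec nat_of_mul_pos.
  by rewrite -modnMm IHe modnMm -addnn expnD -!mulnA [2 ^ k * (A ^ _ * _)]mulnCA.
elim: e => [e IHe | e IHe |] /=.
- rewrite nat_of_mul_pos -modnMmr sqP // modnMmr NatTrec.doubleE expnS.
  by rewrite mulnA.
- by rewrite sqP // NatTrec.doubleE.
by rewrite expn1.
Qed.

Lemma pow_modP a e : odd N ->
  nat_of_pos (pow_mod a e) = nat_of_pos a ^ nat_of_pos e %[mod N].
Proof.
move=> oddN; apply: redcP => //; apply: mont_expP => //.
elim: (k) => [|m IHm]; first by rewrite muln1.
by rewrite iterS double_modP -modnMmr IHm modnMmr expnS mulnCA.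
Qed.

End Montgomery.

Lemma nat_of_pos_gt0 p : 0 < nat_of_pos p.
Proof. by elim: p => //= p; rewrite NatTrec.doubleE double_gt0. Qed.

Lemma nat_of_pos_inj : injective nat_of_pos.
Proof.
move=> p q eq_pq; have: Npos p = Npos q; last by case.
by apply: (can_inj nat_of_binK).
Qed.

Lemma nat_of_pos_onto m : 0 < m -> exists p, nat_of_pos p = m.
Proof.
by case: m => // m _; exists (pos_of_nat m m); apply: (bin_of_natK m.+1).
Qed.

Lemma ltb_nat_of_pos p q : Pos.ltb p q -> nat_of_pos p < nat_of_pos q.
Proof.
move/Pos.ltb_lt/Pos.lt_iff_add => [r <-].
by rewrite nat_of_add_pos -[X in X < _]addn0 ltn_add2l nat_of_pos_gt0.
Qed.

Lemma coprime_nat_of_pos p q : Pos.eqb (Pos.gcd p q) xH ->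
  coprime (nat_of_pos p) (nat_of_pos q).
Proof.
move/Pos.eqb_eq => gcd1.
have [g def_g] : exists g, nat_of_pos g = gcdn (nat_of_pos p) (nat_of_pos q).
  by apply: nat_of_pos_onto; rewrite gcdn_gt0 nat_of_pos_gt0.
have dvP x : gcdn (nat_of_pos p) (nat_of_pos q) %| nat_of_pos x -> Pos.divide g x.
  case/dvdnP=> c def_x; have c_gt0 : 0 < c.
    by move: (nat_of_pos_gt0 x); rewrite def_x; case: (c).
  have [d def_d] := nat_of_pos_onto c_gt0.
  by exists d; apply: nat_of_pos_inj; rewrite nat_of_mul_pos def_d def_g.
have [d] : Pos.divide g xH.
  by rewrite -gcd1; apply: Pos.gcd_greatest; apply: dvP; rewrite (dvdn_gcdl, dvdn_gcdr).
move/(congr1 nat_of_pos)/eqP; rewrite nat_of_mul_pos def_g eq_sym muln_eq1.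
by case/andP.
Qed.

(** * Prime certificates *)

Definition pos_prod (qs : seq positive) : positive := foldr Pos.mul xH qs.

(** The coprimality condition of [pocklington] at each q of qs.  The number
    c * pos_prod qs is the same in all recursive calls, namely m, so that
    c * pos_prod qs' is m / q. *)
Fixpoint check_orders (n : positive) (k : nat) (a m c : positive)
    (qs : seq positive) : bool :=
  if qs is q :: qs' then
    Pos.eqb (Pos.gcd n (Pos.add (pow_mod n k a (Pos.mul c (pos_prod qs'))) m)) xH
    && check_orders n k a m (Pos.mul c q) qs'
  else true.

(** The data of [pocklington]: the base a, and a partial factorization of
    n - 1 as the cofactor times the product of the factors. *)
Record certificate := Certificate {
  candidate : positive;
  base : positive;
  cofactor : positive;
  factors : seq positive
}.

(** The 10 bits in k beyond the size of n leave room for the factors a that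
    [mont_exp] does not reduce, for a up to 16.  As m is even, the result of
    [pow_mod] then lies between 1 and n, and a result congruent to 1 modulo n
    is equal to 1. *)
Definition check_certificate (known : seq positive) (s : certificate) : bool :=
  let: Certificate n a c qs := s in
  let f := pos_prod qs in
  let m := Pos.mul c f in
  let k := Pos.size_nat n + 10 in
  [&& all (fun q => has (Pos.eqb q) known) qs,
      (if n is xI _ then true else false),
      Pos.eqb n (Pos.succ m),
      Pos.ltb n (Pos.mul f f),
      Pos.eqb (pow_mod n k a m) xH
    & check_orders n k a m c qs].

(** Each certificate may use as factors the primes certified before it. *)
Fixpoint check_chain (known : seq positive) (s : seq certificate) : bool :=
  if s is t :: s' then
    check_certificate known t && check_chain (candidate t :: known) s'
  else true.

Definition pos_prime (p : positive) : bool := prime (nat_of_pos p).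

Lemma has_eqb p s : has (Pos.eqb p) s -> all pos_prime s -> pos_prime p.
Proof.
by elim: s => //= q s IHs /orP[/Pos.eqb_eq-> | /IHs IH] /andP[].
Qed.

Lemma nat_of_pos_prod qs :
  nat_of_pos (pos_prod qs) = \prod_(q <- map nat_of_pos qs) q.
Proof.
by elim: qs => [|q qs IHqs] /=; rewrite ?big_nil // big_cons nat_of_mul_pos IHqs.
Qed.

Lemma check_ordersP n k a m c qs : odd (nat_of_pos n) ->
    nat_of_pos m = nat_of_pos c * \prod_(q <- map nat_of_pos qs) q ->
    check_orders n k a m c qs ->
  {in map nat_of_pos qs, forall q, coprime (nat_of_pos n)
     (nat_of_pos a ^ (nat_of_pos m %/ q) + nat_of_pos m)}.
Proof.
move=> odd_n; elim: qs c => [|q qs IHqs] c //=; rewrite big_cons => def_m.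
case/andP=> /coprime_nat_of_pos co_q chk x; rewrite inE => /predU1P[-> | ]; last first.
  by apply: IHqs chk _; rewrite nat_of_mul_pos -mulnA.
have {co_q} := co_q; rewrite nat_of_add_pos.
rewrite -coprime_modr -modnDml pow_modP // modnDml coprime_modr.
by rewrite nat_of_mul_pos nat_of_pos_prod def_m mulnCA mulKn ?nat_of_pos_gt0.
Qed.

Lemma check_certificateP known s : all pos_prime known ->
  check_certificate known s -> pos_prime (candidate s).
Proof.
case: s => n a c qs pr_known /and5P[known_qs odd_n].
move=> /Pos.eqb_eq def_n /ltb_nat_of_pos lt_nff /andP[/Pos.eqb_eq pow1 orders].
have oddN : odd (nat_of_pos n).
  by case: (n) odd_n => //= p _; rewrite NatTrec.doubleE /= odd_double.
set m := Pos.mul _ _ in def_n pow1 orders.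
have def_m : nat_of_pos m = nat_of_pos c * \prod_(q <- map nat_of_pos qs) q.
  by rewrite nat_of_mul_pos nat_of_pos_prod.
have def_N : nat_of_pos n = (nat_of_pos m).+1 by rewrite def_n nat_of_succ_pos.
apply: (@pocklington _ (nat_of_pos a) (nat_of_pos c) (map nat_of_pos qs)).
- by rewrite def_N def_m.
- by rewrite def_N ltnS nat_of_pos_gt0.
- by rewrite nat_of_mul_pos nat_of_pos_prod in lt_nff.
- rewrite all_map; apply: sub_all known_qs => q known_q.
  exact: has_eqb known_q pr_known.
- by rewrite def_N /= -def_N -(pow_modP (Pos.size_nat n + 10)) // pow1.
by rewrite def_N /= -def_N; apply: check_ordersP orders.
Qed.

Lemma check_chainP known s : all pos_prime known -> check_chain known s ->
  all pos_prime (catrev (map candidate s) known).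
Proof.
elim: s known => //= t s IHs known pr_known /andP[chk_t chk_s].
by apply: IHs chk_s; rewrite /= (check_certificateP pr_known chk_t).
Qed.

(** * Verified factorizations of consecutive numbers *)

Definition check_term (known : seq positive) (x : positive)
    (t : positive * positive * positive) : bool :=
  let: (r, a, b) := t in
  [&& all (fun q => has (Pos.eqb q) known) [:: r; a; b],
      ~~ Pos.eqb r a, ~~ Pos.eqb r b, ~~ Pos.eqb a b
    & Pos.eqb x (iter 18 (Pos.mul r) (Pos.mul a b))].

Fixpoint check_run (known : seq positive) (x : positive)
    (s : seq (positive * positive * positive)) : bool :=
  if s is t :: s' then check_term known x t && check_run known (Pos.succ x) s'
  else true.

Lemma check_termP known x t : all pos_prime known -> check_term known x t ->
  tau (nat_of_pos x) = 76.
Proof.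
case: t => [[r a] b] pr_known /and5P[known_rab ra rb ab /Pos.eqb_eq ->].
have /and4P[pr_r pr_a pr_b _] : all pos_prime [:: r; a; b].
  by apply: sub_all known_rab => q known_q; apply: has_eqb known_q pr_known.
have neq p q : ~~ Pos.eqb p q -> nat_of_pos p != nat_of_pos q.
  by apply: contra => /eqP/nat_of_pos_inj->; rewrite Pos.eqb_refl.
rewrite (_ : nat_of_pos _ =
  nat_of_pos r ^ 18 * (nat_of_pos a * nat_of_pos b)) ?tau76 ?neq //.
elim: 18 => [|e IHe]; first by rewrite mul1n nat_of_mul_pos.
by rewrite iterS nat_of_mul_pos IHe expnS mulnA.
Qed.

Lemma check_runP known x s : all pos_prime known -> check_run known x s ->
  forall i, i < size s -> tau (nat_of_pos x + i) = 76.
Proof.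
move=> pr_known; elim: s x => //= t s IHs x /andP[chk_t chk_s] [|i] lt_i.
  by rewrite addn0; apply: check_termP chk_t.
by rewrite addnS -addSn -nat_of_succ_pos; apply: IHs chk_s i lt_i.
Qed.

(** * A run of length seven *)

Definition prime_chain : seq certificate := [::
  Certificate 3 2 1 [:: 2];
  Certificate 5 2 1 [:: 2; 2];
  Certificate 7 2 2 [:: 3];
  Certificate 11 2 2 [:: 5];
  Certificate 13 2 3 [:: 2; 2];
  Certificate 17 3 1 [:: 2; 2; 2; 2];
  Certificate 131 2 10 [:: 13];
  Certificate 263 2 2 [:: 131];
  Certificate 19 2 2 [:: 3; 3];
  Certificate 1597 2 21 [:: 19; 2; 2];
  Certificate 86239 2 54 [:: 1597];
  Certificate 2551 2 34 [:: 5; 5; 3];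
  Certificate 7669 2 71 [:: 3; 3; 3; 2; 2];
  Certificate 2607461 2 340 [:: 7669];
  Certificate 8805176770277 2 844229 [:: 2607461; 2; 2];
  Certificate 41 3 5 [:: 2; 2; 2];
  Certificate 1723 2 21 [:: 41; 2];
  Certificate 5137987 2 1491 [:: 1723; 2];
  Certificate 23 2 2 [:: 11];
  Certificate 461 2 20 [:: 23];
  Certificate 141067 2 306 [:: 461];
  Certificate 2324219893 2 16476 [:: 141067];
  Certificate 51132837647 2 22 [:: 2324219893];
  Certificate 306797025883 2 6 [:: 51132837647];
  Certificate 7247349415369671294991 2 23622619530 [:: 306797025883];
  Certificate 104796672546245446925569861 2 14460 [:: 7247349415369671294991];
  Certificate 302130168788506609570852938763618257456290229423993299 2 561117222571205408014
    [:: 104796672546245446925569861; 5137987];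
  Certificate 335330360768447124891488832371947677074764340304556622950899662841629152876108541051837563 2 1109887046742362558968496492619647838
    [:: 302130168788506609570852938763618257456290229423993299];
  Certificate 103 2 6 [:: 17];
  Certificate 409 7 17 [:: 3; 2; 2; 2];
  Certificate 13907 2 34 [:: 409];
  Certificate 1061074450277 2 740756 [:: 13907; 103];
  Certificate 98359557911286666499 2 92698074 [:: 1061074450277];
  Certificate 240771147617405205897214245679 2 2447867322
    [:: 98359557911286666499];
  Certificate 112727884168594305932066220398603033356099750882391620219 2 468195152467866847112562342
    [:: 240771147617405205897214245679];
  Certificate 5042087208467070352268595748700985530919053694324468731891585159013991504965124063579784160847999531 2 44727950370524054224118929554046175764011870
    [:: 112727884168594305932066220398603033356099750882391620219];
  Certificate 1600650921025539219890483869191117464674500947692857194688838841410263715183218354975911120134484235112199 2 317458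
    [:: 5042087208467070352268595748700985530919053694324468731891585159013991504965124063579784160847999531];
  Certificate 97 5 3 [:: 2; 2; 2; 2; 2];
  Certificate 193 5 3 [:: 2; 2; 2; 2; 2; 2];
  Certificate 21617 2 112 [:: 193];
  Certificate 562043 2 26 [:: 21617];
  Certificate 78686021 2 140 [:: 562043];
  Certificate 2249223457195380943 2 294688566 [:: 78686021; 97];
  Certificate 48590802612402115280521882931787389 2 21603368245586116
    [:: 2249223457195380943];
  Certificate 52906637700435671159737836573788744890981 2 1088820
    [:: 48590802612402115280521882931787389];
  Certificate 455970917413271404500794586483772986766668245403630904168979990876929414898272601 2 8618406635383609215576077771123418964600
    [:: 52906637700435671159737836573788744890981];
  Certificate 127886633768887001316427302491117060852169785989985616239366920428602977987674691419794233 2 280471032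
    [:: 455970917413271404500794586483772986766668245403630904168979990876929414898272601];
  Certificate 241 7 15 [:: 2; 2; 2; 2];
  Certificate 101 2 4 [:: 5; 5];
  Certificate 607 2 6 [:: 101];
  Certificate 2353178753 3 30287 [:: 607; 2; 2; 2; 2; 2; 2; 2];
  Certificate 4706357507 2 2 [:: 2353178753];
  Certificate 2466131333669 2 524 [:: 4706357507];
  Certificate 303404798402073296571798823 2 510492306318
    [:: 2466131333669; 241];
  Certificate 397 5 11 [:: 3; 3; 2; 2];
  Certificate 2383 2 6 [:: 397];
  Certificate 28597 2 12 [:: 2383];
  Certificate 175471193 2 6136 [:: 28597];
  Certificate 29 2 4 [:: 7];
  Certificate 233 2 8 [:: 29];
  Certificate 467 2 2 [:: 233];
  Certificate 9341 2 20 [:: 467];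
  Certificate 74729 2 8 [:: 9341];
  Certificate 149459 2 2 [:: 74729];
  Certificate 72455032939 2 242391 [:: 149459; 2];
  Certificate 6000315110938657190337559 2 471954 [:: 72455032939; 175471193];
  Certificate 1008052938637694407976709913 2 168
    [:: 6000315110938657190337559];
  Certificate 66426656444469510708033276427049 2 65896
    [:: 1008052938637694407976709913];
  Certificate 1854636612273484401063309065883116870135835950354618074524087720551284252168958745972251127604293159685121 2 92022492224051193001987964395221201341560386560
    [:: 66426656444469510708033276427049; 303404798402073296571798823];
  Certificate 4999 3 51 [:: 7; 7; 2];
  Certificate 19997 2 4 [:: 4999];
  Certificate 1585362161 3 4955 [:: 19997; 2; 2; 2; 2];
  Certificate 103939513999483 2 65562 [:: 1585362161];
  Certificate 7297 5 57 [:: 2; 2; 2; 2; 2; 2; 2];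
  Certificate 151 3 6 [:: 5; 5];
  Certificate 586787 2 134 [:: 151; 29];
  Certificate 4016314085183 2 938 [:: 586787; 7297];
  Certificate 8032628170367 2 2 [:: 4016314085183];
  Certificate 444477447179087579 2 55334 [:: 8032628170367];
  Certificate 111060821920861099057598250172870115920148239285334594587 2 2403977904542111552254698
    [:: 444477447179087579; 103939513999483];
  Certificate 108374692120409282717705793184051540808282561225010735773300494046568175921658013011767996253565026851 2 975813885094728734390582250876880833228092550
    [:: 111060821920861099057598250172870115920148239285334594587];
  Certificate 2917 3 4 [:: 3; 3; 3; 3; 3; 3];
  Certificate 81677 2 28 [:: 2917];
  Certificate 2123603 2 26 [:: 81677];
  Certificate 394990159 2 186 [:: 2123603];
  Certificate 25073185313003 2 63478 [:: 394990159];
  Certificate 2309892270145714379 2 92126 [:: 25073185313003];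
  Certificate 32380069842902624164823 2 14018 [:: 2309892270145714379];
  Certificate 64760139685805248329647 2 2 [:: 32380069842902624164823];
  Certificate 10851307524704558220484844722670431898709631 2 167561521289971096290
    [:: 64760139685805248329647];
  Certificate 70868457071252208736301416884257198233461970389709 2 6530868
    [:: 10851307524704558220484844722670431898709631];
  Certificate 126487656480860726009871340217315919118407660661468479769551812273099 2 1784823061036705522
    [:: 70868457071252208736301416884257198233461970389709];
  Certificate 20051358042764359388107147768410787142004255023405266761863477020769498831327907241531441312583 2 158524227585783423965523218
    [:: 126487656480860726009871340217315919118407660661468479769551812273099];
  Certificate 380815391948180713498930950417657669400944811404512826341311155578454321804579614331165133408576337 2 18992
    [:: 20051358042764359388107147768410787142004255023405266761863477020769498831327907241531441312583];
  Certificate 67 2 6 [:: 11];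
  Certificate 7639 3 57 [:: 67; 2];
  Certificate 94173593 3 1541 [:: 7639; 2; 2; 2];
  Certificate 9794053673 2 104 [:: 94173593];
  Certificate 58764322039 2 6 [:: 9794053673];
  Certificate 1057757796703 2 18 [:: 58764322039];
  Certificate 4231031186813 2 4 [:: 1057757796703];
  Certificate 2944797706021849 2 696 [:: 4231031186813];
  Certificate 1462422570979930825448788771393 2 496612235193408
    [:: 2944797706021849];
  Certificate 2789 2 41 [:: 17; 2; 2];
  Certificate 39047 2 14 [:: 2789];
  Certificate 21319663 2 546 [:: 39047];
  Certificate 263911448907290677 2 64138764 [:: 21319663; 193];
  Certificate 6333874773774976249 2 24 [:: 263911448907290677];
  Certificate 52008548673909968693387054282927949419 2 4105587064118176541
    [:: 6333874773774976249; 2];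
  Certificate 25333943489199161434083320461095076161374284820934020878507243522931737240365097471 2 333085081372410
    [:: 52008548673909968693387054282927949419; 1462422570979930825448788771393]]%positive.

Definition run_start : positive :=
  1240249925084029572117299574097269525241270765972260312347036293562715636310478359357086138766079256259918212890621.

(** The triples (r, a, b) with [run_start + i] = r^18 * a * b. *)
Definition run_factors : seq (positive * positive * positive) := [::
  (17, 263,
   335330360768447124891488832371947677074764340304556622950899662841629152876108541051837563);
  (3, 2,
   1600650921025539219890483869191117464674500947692857194688838841410263715183218354975911120134484235112199);
  (13, 86239,
   127886633768887001316427302491117060852169785989985616239366920428602977987674691419794233);
  (2, 2551,
   1854636612273484401063309065883116870135835950354618074524087720551284252168958745972251127604293159685121);
  (5, 3,
   108374692120409282717705793184051540808282561225010735773300494046568175921658013011767996253565026851);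
  (7, 2,
   380815391948180713498930950417657669400944811404512826341311155578454321804579614331165133408576337);
  (11, 8805176770277,
   25333943489199161434083320461095076161374284820934020878507243522931737240365097471)]%positive.

Lemma run76_of_length7 : has_run 76 7.
Proof.
exists (nat_of_pos run_start); first exact: nat_of_pos_gt0.
have [chain run] : check_chain [:: 2%positive] prime_chain /\
    check_run (catrev (map candidate prime_chain) [:: 2%positive])
      run_start run_factors.
  by split; vm_compute.
exact: check_runP (check_chainP (isT : all pos_prime [:: 2%positive]) chain) run.
Qed.

Theorem mainTheorem7 : is_M 76 7.
Proof. by split; [exact: run76_of_length7 | exact: run76_le7]. Qed.
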